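(* Let $\{a_n\}_{n\ge 1}$ be a sequence of positive real numbers and let $m\geq 1$ be a fixed positive integer. If there exist a sequence $\{q_n\}_{n\ge 1}$ of positive real numbers and a real number $c>0$ such that $\sum \frac{1}{q_n}$ diverges and $$q_n a_n\geq c \quad\text{and}\quad q_n\frac{a_n}{a_{n+m}}-q_{n+m}\leq 0$$ for all $n$ sufficiently large, then $\sum_{n=1}^{\infty} a_n$ diverges. Conversely, if $\sum_{n=1}^\infty a_n$ diverges, then there exist a sequence $\{q_n\}_{n\ge1}$ of positive real numbers and a real number $c>0$ such that $\sum\frac{1}{q_n}$ diverges and the two inequalities above hold for all $n$ sufficiently large. *)

(* Defs.v *)
From mathcomp Require Import all_boot all_order all_algebra.
From mathcomp Require Import all_classical all_reals all_analysis.
Set Implicit Arguments.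
Unset Strict Implicit.
Unset Printing Implicit Defensive.
Import Order.TTheory GRing.Theory Num.Theory.
Import numFieldNormedType.Exports.
Local Open Scope classical_set_scope.
Local Open Scope ring_scope.

(* Sequences indexed by n >= 1 are functions on nat whose value at 0 is
   never used. *)
Definition positive_seq1 (R : realType) (u : R^nat) : Prop :=
  forall n : nat, (1 <= n)%N -> 0 < u n.

Definition partial_sum1 (R : realType) (u : R^nat) : R^nat :=
  [sequence \sum_(1 <= k < n.+1) u k]_n.

Definition series1_diverges (R : realType) (u : R^nat) : Prop :=
  ~ cvgn (partial_sum1 u).

(* Main.v *)
Require Import Defs.
From mathcomp Require Import all_boot all_order all_algebra.
From mathcomp Require Import all_classical all_reals all_analysis.
Import Order.TTheory GRing.Theory Num.Theory.
Import numFieldNormedType.Exports.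
Local Open Scope classical_set_scope.
Local Open Scope ring_scope.

(** The bound [c <= q n * a n] says [1 / q n <= c^-1 * a n] for large [n], so
    convergence of the series of [a] would force convergence of the series of
    [1 / q] by the eventual comparison test ([series_le_cvg_near]).
    Conversely, if the series of [a] diverges, take [q n = 1 / a n] and [c = 1]:
    then [1 / q n] is [a n] itself, [q n * a n = 1], and both terms of
    [q n * (a n / a (n + m)) - q (n + m)] equal [1 / a (n + m)]. *)

Lemma is_cvg_series_shiftn (R : realType) (u : R^nat) (N : nat) :
  cvgn (series (fun n => u (n + N)%N)) = cvgn (series u).
Proof.
rewrite -(is_cvg_series_restrict N u).
set S := (X in _ = cvgn X).
have -> : series (fun n => u (n + N)%N) = (fun n => S (n + N)%N).
  by apply/funext => n; rewrite seriesEnat /S /= -{2}[N]add0n big_addn addnK.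
rewrite propeqE; split=> /cvg_ex[l]; first by rewrite cvg_shiftn => /cvgP.
by move=> Sl; apply/cvg_ex; exists l; rewrite cvg_shiftn.
Qed.

(** [partial_sum1 u] is the series of [u] without its term of index 0, so
    library results on [series] transfer to [series1_diverges]. *)
Lemma is_cvg_partial_sum1 (R : realType) (u : R^nat) :
  cvgn (partial_sum1 u) = cvgn (series u).
Proof.
rewrite -(is_cvg_series_shiftn R u 1).
suff -> : partial_sum1 u = series (fun n => u (n + 1)%N) by [].
apply/funext => n; rewrite seriesEnat /partial_sum1 /= big_add1.
by apply: eq_bigr => k _; rewrite addn1.
Qed.

(** Convergence of a series depends only on a tail, so it suffices to compare
    the two series from the index on at which the bounds hold. *)
Lemma series_le_cvg_near (R : realType) (u v : R^nat) :
  (\forall n \near \oo, 0 <= u n <= v n) ->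
  cvgn (series v) -> cvgn (series u).
Proof.
move=> [N _ uv]; rewrite -(is_cvg_series_shiftn R u N).
rewrite -(is_cvg_series_shiftn R v N).
have {}uv n : 0 <= u (n + N)%N <= v (n + N)%N by apply: uv; rewrite /= leq_addl.
apply: series_le_cvg => n; case/andP: (uv n) => // u0 /(le_trans u0).
exact.
Qed.

Theorem theorem2p2 (R : realType) (a : R^nat) (m : nat)
    (a_pos : positive_seq1 a) (m_ge1 : (1 <= m)%N) :
  ((exists (q : R^nat) (c : R),
      [/\ positive_seq1 q, 0 < c,
          series1_diverges (fun n => 1 / q n) &
          \forall n \near \oo,
            c <= q n * a n /\
            q n * (a n / a (n + m)%N) - q (n + m)%N <= 0]) ->
    series1_diverges a)
  /\
  (series1_diverges a ->
    exists (q : R^nat) (c : R),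
      [/\ positive_seq1 q, 0 < c,
          series1_diverges (fun n => 1 / q n) &
          \forall n \near \oo,
            c <= q n * a n /\
            q n * (a n / a (n + m)%N) - q (n + m)%N <= 0]).
Proof.
split=> [[q [c [q_pos c_gt0 q_div qa]]]|a_div].
- apply: contra_not q_div; rewrite !is_cvg_partial_sum1 => a_cvg.
  apply: series_le_cvg_near (is_cvg_seriesZ (k := c^-1) a_cvg).
  near=> n.
  have qn_gt0 : 0 < q n by apply: q_pos; near: n; exact: nbhs_infty_ge.
  have [cqa _] : c <= q n * a n /\ q n * (a n / a (n + m)%N) - q (n + m)%N <= 0.
    by near: n.
  rewrite divr_ge0 ?(ltW qn_gt0)//=.
  rewrite [leRHS]/(c^-1 * a n) ler_pdivrMr// -mulrA ler_pdivlMl// mulr1.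
  by rewrite mulrC.
- exists (fun n => 1 / a n), 1; split => //.
  + by move=> n n1; rewrite divr_gt0// a_pos.
  + by under [X in series1_diverges X]eq_fun do rewrite !div1r invrK.
  + near=> n.
    have an_neq0 : a n != 0.
      by rewrite gt_eqF// a_pos//; near: n; exact: nbhs_infty_ge.
    by rewrite !div1r mulrA !mulVf// mul1r subrr.
Unshelve. all: by end_near. Qed.
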